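(* (Plancherel formula.) Let $R$ be a commutative ring with unit, $n\ge0$, and let $A$ be an object of the strong category $\mathcal S_n$ of $n$-fold filtered $R$-modules built from the finite $R$-modules. For every $f\in\mathcal E_n(A)$ and every $g\in\mathcal E_n'(A)$ one has $$\langle f,g\rangle=\langle\mathbb F f,\mathbb F'g\rangle.$$ For $f\in\tilde{\mathcal E}_n(\hat A)$ and $g\in\tilde{\mathcal E}_n'(\hat A)$ one has $$\langle f,g\rangle=\langle\tilde{\mathbb F}f,\tilde{\mathbb F}'g\rangle.$$
   Context: Filtrations. A partially ordered set is filtering if any two elements have a lower bound and an upper bound in it. A filtration on an object $A$ of an abelian category $\mathcal A$ is, up to natural isomorphism, a family of subobjects $F(i)\subset A$ indexed by a filtering partially ordered set $I_F$ with $F(i)\subset F(j)$ for $i\le j$, $\bigcap_iF(i)=0$, $\bigcup_iF(i)=A$. An order preserving map $\phi:I\to J$ of filtering sets is cofinal if for every $j\in J$ there are $i_1,i_2\in I$ with $\phi(i_1)\le j\le\phi(i_2)$. A sub-filtration of $F$ is a pair $(\phi,S)$ with $\phi:I_S\to I_F$ cofinal and $S$ a filtration with $S\cong F\circ\phi$. Let $\sim$ be the equivalence relation generated by $F\sim S$ whenever $S$ is a sub-filtration of $F$; $[F]$ is the class of $F$. All filtrations have countable index set. The categories $\mathcal A_n$. Here $\mathcal A$ is the category of $R$-modules and $\mathcal A_0$ the full subcategory of modules that are finite as sets. Objects $A$ of $\mathcal A_0$ are regarded as trivially filtered ($I_F=\{0,\infty\}$, $F(0)=0$, $F(\infty)=A$).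 For $n\ge1$, an object of $\mathcal A_n$ is a class $(A,[F])$ of filtrations together with a class of filtrations $[E_{i,j}]$ on $F(j)/F(i)$ for all $i\le j$, such that $(F(j)/F(i),[E_{i,j}])$ is an object of $\mathcal A_{n-1}$ and the natural maps $F(i)/F(j)\to F(k)/F(l)$ ($j\le i$, $l\le k$, $k\ge i$, $l\ge j$) are morphisms in $\mathcal A_{n-1}$. A morphism $(A,[F])\to(B,[G])$ in $\mathcal A_n$ is a morphism $\phi:A\to B$ in $\mathcal A$ such that for every $i\in I_F$, $j\in I_G$ there exist $i_0\le i$, $j_0\ge j$ such that for all $i'\le i_0$, $j'\ge j_0$ one has $\phi(F(i'))\subset G(j)$, $\phi(F(i))\subset G(j')$, and the induced map $F(i)/F(i')\to G(j')/G(j)$ is a morphism in $\mathcal A_{n-1}$. The strong categories. A sequence $0\to A\xrightarrow{\alpha}B\xrightarrow{\beta}C\to0$ in $\mathcal A_n$ is exact if $\alpha$ is the kernel of $\beta$ and $\beta$ the cokernel of $\alpha$. A morphism $\phi$ in $\mathcal A_n$ is quasi-strong if the canonical map $\operatorname{coker}(\ker\phi)\to\ker(\operatorname{coker}\phi)$ is an isomorphism. Put $\mathcal S_0=\mathcal A_0$. For $n\ge1$, $(A,[F])$ in $\mathcal A_n$ is strong if for all $i\le j$ the quotient $F(j)/F(i)$ is strong in $\mathcal A_{n-1}$ and for all $i\le j\le k$ the sequence $F(j)/F(i)\to F(k)/F(i)\to F(k)/F(j)$ is exact in $\mathcal A_{n-1}$. A morphism is strong if it is quasi-strong with strong source and target.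 $\mathcal S_n$ is the category of strong objects and strong morphisms. For $i\le j\le k$ let $\alpha_{ijk}:F(j)/F(i)\to F(k)/F(i)$ and $\pi_{ijk}:F(k)/F(i)\to F(k)/F(j)$ be the natural maps. Dual. For $n=0$, $\hat A=\operatorname{Hom}_{\mathbb Z}(A,\mathbb Q/\mathbb Z)$ with $(r\alpha)(a)=\alpha(ra)$. For $n>0$, $\hat A=\varinjlim_i\varprojlim_j\widehat{F(j)/F(i)}$, with filtration $\hat F(i)=\varprojlim_j\widehat{F(j)/F(i)}$ indexed by $I_F$ with the opposite order; one has $\hat F(i)/\hat F(j)=\widehat{F(j)/F(i)}$ for $i\le j$. Function spaces. For a set $A$ let $C(A)$ be the space of all maps $A\to\mathbb C$. For $\phi:A\to B$ let $\phi^*(f)=f\circ\phi$, and for finite $A,B$ let $\phi_*(f)(x)=\sum_{y:\phi(y)=x}f(y)$. For $A\in\mathcal S_0$ put $\mathcal E_0(A)=\tilde{\mathcal E}_0(A)=\mathcal E_0'(A)=\tilde{\mathcal E}_0'(A)=C(A)$, where $\mathcal E_0,\tilde{\mathcal E}_0$ are contravariant via $\phi^*$ and $\mathcal E_0',\tilde{\mathcal E}_0'$ covariant via $\phi_*$. For $n>0$ and $(A,[F])\in\mathcal S_n$: $\mathcal E_n(A)=\varprojlim_j\varinjlim_i\mathcal E_{n-1}(F(j)/F(i))$, $\tilde{\mathcal E}_n(A)=\varinjlim_i\varprojlim_j\tilde{\mathcal E}_{n-1}(F(j)/F(i))$ (limits with respect to $\pi_{ijk}^*$, $\alpha_{ijk}^*$),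 $\mathcal E_n'(A)=\varinjlim_j\varprojlim_i\mathcal E_{n-1}'(F(j)/F(i))$, $\tilde{\mathcal E}_n'(A)=\varprojlim_i\varinjlim_j\tilde{\mathcal E}_{n-1}'(F(j)/F(i))$ (limits with respect to $(\pi_{ijk})_*$, $(\alpha_{ijk})_*$). For a kernel or cokernel $\phi:(A,[F])\to(B,[G])$ (a kernel is a map that is the kernel of its cokernel, a cokernel one that is the cokernel of its kernel), with the filtrations chosen induced one by the other, $\phi^*$ and $\phi_*$ are the limits of the maps for $\phi_{ij}:F(j)/F(i)\to G(j)/G(i)$. Pairings. There are pairings between $\mathcal E_n(A)$ and $\mathcal E_n'(A)$, and between $\tilde{\mathcal E}_n(A)$ and $\tilde{\mathcal E}_n'(A)$, denoted $\langle\cdot,\cdot\rangle$ (the order of arguments is immaterial). For $n=0$, $\langle f,g\rangle=\sum_{a\in A}f(a)g(a)$. For $n>0$ they are obtained inductively by taking limits, using that the dual of an injective limit is the projective limit of the duals: explicitly $\langle f,g\rangle=\langle f_{ij},g_{ij}\rangle$, where for $i$ sufficiently small and $j$ sufficiently large $f_{ij},g_{ij}$ are the components of $f,g$ in the spaces attached to $F(j)/F(i)$. Fourier transforms. For $A\in\mathcal S_0$, $f\in C(A)$, $\alpha\in\hat A$: $\mathbb F f(\alpha)=\tilde{\mathbb F}f(\alpha)=\frac1{|A|}\sum_{a\in A}f(a)e^{-2\pi i\alpha(a)}$ and $\mathbb F'f(\alpha)=\tilde{\mathbb F}'f(\alpha)=\sum_{a\in A}f(a)e^{2\pi i\alpha(a)}$.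 For $n>0$ the maps $\mathbb F:\mathcal E_n(A)\to\tilde{\mathcal E}_n'(\hat A)$, $\mathbb F':\mathcal E_n'(A)\to\tilde{\mathcal E}_n(\hat A)$, $\tilde{\mathbb F}:\tilde{\mathcal E}_n(A)\to\mathcal E_n'(\hat A)$, $\tilde{\mathbb F}':\tilde{\mathcal E}_n'(A)\to\mathcal E_n(\hat A)$ are obtained by taking limits of the corresponding maps for the quotients $F(j)/F(i)$, whose duals are $\hat F(i)/\hat F(j)$. *)

(* Defs.v *)
From HB Require Import structures.
From mathcomp Require Import all_boot all_order all_algebra.
From mathcomp Require Import finmap ring_quotient complex.
From mathcomp Require Import all_classical all_reals all_analysis.

Set Implicit Arguments.
Unset Strict Implicit.
Unset Printing Implicit Defensive.

Import Order.TTheory GRing.Theory Num.Theory.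

Local Open Scope classical_set_scope.
Local Open Scope ring_scope.

Section Modules.
Variable R : comPzRingType.

Record submodule (M : lmodType R) := Submodule {
  smem :> M -> Prop;
  smem0 : smem 0;
  smemP : forall (r : R) (x y : M), smem x -> smem y -> smem (r *: x + y) }.

Definition smem_pred (M : lmodType R) (S : submodule M) : {pred M} :=
  fun x => `[< S x >].

Lemma smem_pred_closed (M : lmodType R) (S : submodule M) :
  submod_closed (smem_pred S).
Proof.
split; first exact/asboolP/smem0.
by move=> r x y /asboolP Sx /asboolP Sy; apply/asboolP/smemP.
Qed.

HB.instance Definition _ (M : lmodType R) (S : submodule M) :=
  GRing.isSubmodClosed.Build R M (smem_pred S) (smem_pred_closed S).

Definition sub_lmod (M : lmodType R) (S : submodule M) : Type :=
  {x : M | x \in smem_pred S}.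
HB.instance Definition _ (M : lmodType R) (S : submodule M) :=
  SubChoice.on (sub_lmod S).
HB.instance Definition _ (M : lmodType R) (S : submodule M) :=
  [SubChoice_isSubLmodule of sub_lmod S by <:].

Definition span_set (M : lmodType R) (S : set M) (x : M) : Prop :=
  forall N : submodule M, (forall y, S y -> N y) -> N x.

Fact span_set0 (M : lmodType R) (S : set M) : span_set S 0.
Proof. by move=> N _; exact: smem0. Qed.

Fact span_setP (M : lmodType R) (S : set M) (r : R) x y :
  span_set S x -> span_set S y -> span_set S (r *: x + y).
Proof. by move=> Sx Sy N SN; apply: smemP; [exact: Sx|exact: Sy]. Qed.

Definition span (M : lmodType R) (S : set M) : submodule M :=
  Submodule (@span_set0 M S) (@span_setP M S).

Lemma sub_span (M : lmodType R) (S : set M) x : S x -> span S x.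
Proof. by move=> Sx N; apply. Qed.

Definition lprod (J : Type) (V : J -> lmodType R) : Type := forall j, V j.

Section Lprod.
Variables (J : Type) (V : J -> lmodType R).
Implicit Types u v : lprod V.

HB.instance Definition _ := gen_eqMixin (lprod V).
HB.instance Definition _ := gen_choiceMixin (lprod V).

Definition lprod_zero : lprod V := fun=> 0.
Definition lprod_opp u : lprod V := fun j => - u j.
Definition lprod_add u v : lprod V := fun j => u j + v j.
Definition lprod_scale (r : R) u : lprod V := fun j => r *: u j.

Fact lprod_addA : associative lprod_add.
Proof. by move=> u v w; apply: functional_extensionality_dep => j; exact: addrA. Qed.
Fact lprod_addC : commutative lprod_add.
Proof. by move=> u v; apply: functional_extensionality_dep => j; exact: addrC. Qed.
Fact lprod_add0 : left_id lprod_zero lprod_add.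
Proof. by move=> u; apply: functional_extensionality_dep => j; exact: add0r. Qed.
Fact lprod_addN : left_inverse lprod_zero lprod_opp lprod_add.
Proof. by move=> u; apply: functional_extensionality_dep => j; exact: addNr. Qed.

HB.instance Definition _ := GRing.isZmodule.Build (lprod V)
  lprod_addA lprod_addC lprod_add0 lprod_addN.

Fact lprod_scaleA r s u :
  lprod_scale r (lprod_scale s u) = lprod_scale (r * s) u.
Proof. by apply: functional_extensionality_dep => j; exact: scalerA. Qed.
Fact lprod_scale1 : left_id 1 lprod_scale.
Proof. by move=> u; apply: functional_extensionality_dep => j; exact: scale1r. Qed.
Fact lprod_scaleDr : right_distributive lprod_scale +%R.
Proof. by move=> r u v; apply: functional_extensionality_dep => j; exact: scalerDr. Qed.
Fact lprod_scaleDl u : {morph lprod_scale^~ u : r s / r + s}.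
Proof. by move=> r s; apply: functional_extensionality_dep => j; exact: scalerDl. Qed.

HB.instance Definition _ := GRing.Zmodule_isLmodule.Build R (lprod V)
  lprod_scaleA lprod_scale1 lprod_scaleDr lprod_scaleDl.
End Lprod.

Definition int_pred : {pred rat} := fun q => q \is a Num.int.

Fact int_pred_closed : zmod_closed int_pred.
Proof. by split=> [|x y xZ yZ]; [exact: rpred0|exact: rpredB]. Qed.

HB.instance Definition _ := GRing.isZmodClosed.Build rat int_pred int_pred_closed.

Definition QZ : zmodType := Quotient.quot int_pred.

Definition hom_pred (M : lmodType R) : {pred M -> QZ} :=
  fun f => `[< {morph f : x y / x + y} >].

Lemma hom_pred_closed (M : lmodType R) : zmod_closed (@hom_pred M).
Proof.
split; first by apply/asboolP => x y; rewrite addr0.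
move=> f g /asboolP fD /asboolP gD; apply/asboolP => x y.
by rewrite !fctE fD gD opprD addrACA.
Qed.

HB.instance Definition _ (M : lmodType R) :=
  GRing.isZmodClosed.Build (M -> QZ) (@hom_pred M) (@hom_pred_closed M).

Definition homQZ (M : lmodType R) : Type := {f : M -> QZ | f \in @hom_pred M}.
HB.instance Definition _ (M : lmodType R) := SubChoice.on (homQZ M).
HB.instance Definition _ (M : lmodType R) :=
  [SubChoice_isSubZmodule of homQZ M by <:].

Section HomScale.
Variable M : lmodType R.
Implicit Types f g : homQZ M.

Fact homQZ_scale_subproof (r : R) f : (fun a => \val f (r *: a)) \in @hom_pred M.
Proof.
apply/asboolP => x y; rewrite scalerDr.
by have /asboolP fD := valP f; exact: fD.
Qed.

Definition homQZ_scale (r : R) f : homQZ M :=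
  exist (fun h : M -> QZ => h \in @hom_pred M) _ (homQZ_scale_subproof r f).

Fact homQZ_scaleA r s f : homQZ_scale r (homQZ_scale s f) = homQZ_scale (r * s) f.
Proof. by apply: val_inj; apply/funext => a /=; rewrite scalerA mulrC. Qed.
Fact homQZ_scale1 : left_id 1 homQZ_scale.
Proof. by move=> f; apply: val_inj; apply/funext => a /=; rewrite scale1r. Qed.
Fact homQZ_scaleDr : right_distributive homQZ_scale +%R.
Proof. by move=> r f g; apply: val_inj; apply/funext => a. Qed.
Fact homQZ_scaleDl f : {morph homQZ_scale^~ f : r s / r + s}.
Proof.
move=> r s; apply: val_inj; apply/funext => a /=.
by rewrite scalerDl; have /asboolP fD := valP f; exact: fD.
Qed.

HB.instance Definition _ := GRing.Zmodule_isLmodule.Build R (homQZ M)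
  homQZ_scaleA homQZ_scale1 homQZ_scaleDr homQZ_scaleDl.
End HomScale.

(* Subobjects [F i] of [M] are given by maps [incl i : part i -> M], the
   quotient [F j / F i] by a map [proj i j : part j -> quo i j]; that [incl i]
   is injective, [proj i j] surjective with kernel [F i], etc., is the content
   of [is_filtration] below.  The data [quo i j] are irrelevant unless
   [i <= j]. *)
Record filtration (T : lmodType R -> Type) (M : lmodType R) := Filtration {
  idx_disp : Order.disp_t;
  idx : porderType idx_disp;
  part : idx -> lmodType R;
  incl : forall i, {linear part i -> M};
  quo : idx -> idx -> lmodType R;
  proj : forall i j, {linear part j -> quo i j};
  quo_str : forall i j, T (quo i j) }.
Arguments incl {T M} F i : rename.
Arguments proj {T M} F i j : rename.
Arguments quo_str {T M} F i j : rename.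

(* An object of A_n is a module with equivalence classes of filtrations on it
   and, recursively, on the quotients.  [nfil n M] is the data obtained by
   choosing a representative of each class; all notions below are expressed
   through such representatives. *)
Fixpoint nfil (n : nat) : lmodType R -> Type :=
  match n with
  | 0 => fun=> unit
  | m.+1 => filtration (nfil m)
  end.

(* [psi : F j / F i -> G l / G k] is the map induced by [phi : M -> N]; this
   includes [phi (F i) `<=` G k] and [phi (F j) `<=` G l]. *)
Definition induced (T T' : lmodType R -> Type) (M N : lmodType R)
    (F : filtration T M) (G : filtration T' N) (phi : M -> N)
    (i j : idx F) (k l : idx G) (psi : quo i j -> quo k l) : Prop :=
  (forall x : part i, exists y : part k, incl G k y = phi (incl F i x)) /\
  (forall x : part j, exists2 y : part l,
     incl G l y = phi (incl F j x) & psi (proj F i j x) = proj G k l y).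

Definition filtering d (I : porderType d) : Prop :=
  forall i j : I, (exists k, (k <= i)%O && (k <= j)%O) /\
                  (exists k, (i <= k)%O && (j <= k)%O).

Record is_filtration (T : lmodType R -> Type) (M : lmodType R)
    (F : filtration T M) : Prop := IsFiltration {
  fil_filtering : filtering (idx F);
  fil_countable : countable [set: idx F];
  fil_incl : forall i, injective (incl F i);
  fil_mono : forall i j, (i <= j)%O -> range (incl F i) `<=` range (incl F j);
  fil_bigcap : \bigcap_i range (incl F i) = [set 0];
  fil_bigcup : \bigcup_i range (incl F i) = [set: M];
  fil_proj_surj : forall i j, (i <= j)%O -> range (proj F i j) = [set: quo i j];
  fil_proj_ker : forall i j, (i <= j)%O -> forall x : part j,
    proj F i j x = 0 <-> range (incl F i) (incl F j x) }.

Fixpoint mor (n : nat) : forall M N : lmodType R,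
    nfil n M -> nfil n N -> {linear M -> N} -> Prop :=
  match n with
  | 0 => fun _ _ _ _ _ => True
  | m.+1 => fun M N (F : filtration (nfil m) M) (G : filtration (nfil m) N) phi =>
      forall (i : idx F) (j : idx G), exists (i0 : idx F) (j0 : idx G),
        [/\ (i0 <= i)%O, (j <= j0)%O &
         forall (i' : idx F) (j' : idx G), (i' <= i0)%O -> (j0 <= j')%O ->
         exists2 psi : {linear quo i' i -> quo j j'},
           induced phi psi & mor (quo_str F i' i) (quo_str G j j') psi]
  end.

Fixpoint in_A (n : nat) : forall M : lmodType R, nfil n M -> Prop :=
  match n with
  | 0 => fun M _ => finite_set [set: M]
  | m.+1 => fun M (F : filtration (nfil m) M) =>
      [/\ is_filtration F,
          forall i j : idx F, (i <= j)%O -> in_A (quo_str F i j) &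
          forall i j k l : idx F,
            (j <= i)%O -> (l <= k)%O -> (i <= k)%O -> (j <= l)%O ->
            exists2 psi : {linear quo j i -> quo l k},
              induced idfun psi & mor (quo_str F j i) (quo_str F l k) psi]
  end.

Section Exactness.
Variable n : nat.

Definition is_kernel (L M N : lmodType R)
    (u : nfil n L) (s : nfil n M) (t : nfil n N)
    (alpha : {linear L -> M}) (beta : {linear M -> N}) : Prop :=
  [/\ mor u s alpha, mor s t beta, forall x, beta (alpha x) = 0 &
   forall (T : lmodType R) (w : nfil n T) (tau : {linear T -> M}),
     in_A w -> mor w s tau -> (forall x, beta (tau x) = 0) ->
     (exists2 sigma : {linear T -> L},
        mor w u sigma & forall x, alpha (sigma x) = tau x) /\
     (forall sigma sigma' : {linear T -> L}, mor w u sigma -> mor w u sigma' ->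
        (forall x, alpha (sigma x) = tau x) ->
        (forall x, alpha (sigma' x) = tau x) -> sigma =1 sigma')].

Definition is_cokernel (L M N : lmodType R)
    (u : nfil n L) (s : nfil n M) (t : nfil n N)
    (alpha : {linear L -> M}) (beta : {linear M -> N}) : Prop :=
  [/\ mor u s alpha, mor s t beta, forall x, beta (alpha x) = 0 &
   forall (T : lmodType R) (w : nfil n T) (tau : {linear M -> T}),
     in_A w -> mor s w tau -> (forall x, tau (alpha x) = 0) ->
     (exists2 sigma : {linear N -> T},
        mor t w sigma & forall x, sigma (beta x) = tau x) /\
     (forall sigma sigma' : {linear N -> T}, mor t w sigma -> mor t w sigma' ->
        (forall x, sigma (beta x) = tau x) ->
        (forall x, sigma' (beta x) = tau x) -> sigma =1 sigma')].

Definition exact (L M N : lmodType R)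
    (u : nfil n L) (s : nfil n M) (t : nfil n N)
    (alpha : {linear L -> M}) (beta : {linear M -> N}) : Prop :=
  is_kernel u s t alpha beta /\ is_cokernel u s t alpha beta.
End Exactness.

Fixpoint strong (n : nat) : forall M : lmodType R, nfil n M -> Prop :=
  match n with
  | 0 => fun _ _ => True
  | m.+1 => fun M (F : filtration (nfil m) M) =>
      (forall i j : idx F, (i <= j)%O -> strong (quo_str F i j)) /\
      (forall i j k : idx F, (i <= j)%O -> (j <= k)%O ->
       exists (alpha : {linear quo i j -> quo i k})
              (pi : {linear quo i k -> quo j k}),
         [/\ induced idfun alpha, induced idfun pi &
             exact (quo_str F i j) (quo_str F i k) (quo_str F j k) alpha pi])
  end.

Definition in_S (n : nat) (M : lmodType R) (s : nfil n M) : Prop :=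
  in_A s /\ strong s.

(* All transition maps of the limits defining the dual are transposes of the
   maps [alpha_ijk], [pi_ijk].  An element of
   [hat F i = lim_j hat (F j / F i)] is thus a family of characters [psi j] of
   [F j / F i] ([i <= j]) which agree with each other on the subobjects [F j],
   that is, which come from one character [chi] of [M] as [M = U_j F j].  The
   module [hat F i] is realized as the module of these pairs [(chi, psi)], with
   [psi j = 0] when [j] is not above [i], and its inclusion into the dual is
   [(chi, psi) |-> chi]. *)
Section DualPart.
Variables (T : lmodType R -> Type) (M : lmodType R) (F : filtration T M).
Variable D : forall i j : idx F, submodule (homQZ (quo i j)).

Definition dual_fam (i : idx F) : lmodType R :=
  (homQZ M * lprod (fun j => sub_lmod (D i j)))%type.

Definition dual_part_pred (i : idx F) (c : dual_fam i) : Prop :=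
  forall j : idx F,
    if (i <= j)%O
    then forall x : part j, \val c.1 (incl F j x) = \val (\val (c.2 j)) (proj F i j x)
    else c.2 j = 0.

Fact dual_part0 i : @dual_part_pred i 0.
Proof. by move=> j; case: ifP. Qed.

Fact dual_partP i (r : R) (c d : dual_fam i) :
  dual_part_pred c -> dual_part_pred d -> dual_part_pred (r *: c + d).
Proof.
move=> Pc Pd j; move: (Pc j) (Pd j); case: ifP => _ Ec Ed; last first.
  by rewrite [LHS]/(r *: c.2 j + d.2 j) Ec Ed scaler0; exact: addr0.
move=> x; rewrite [LHS]/(\val c.1 (r *: incl F j x) + \val d.1 (incl F j x)).
rewrite -linearZ Ec Ed.
rewrite [RHS]/(\val (\val (c.2 j)) (r *: proj F i j x) + \val (\val (d.2 j)) (proj F i j x)).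
by rewrite linearZ.
Qed.

Definition dual_part (i : idx F) : submodule (dual_fam i) :=
  Submodule (@dual_part0 i) (@dual_partP i).

(* In the abelian category of modules the union of the [hat F i] is their sum;
   for strong [M] these form a directed family. *)
Definition dual_sum : submodule (homQZ M) :=
  span [set chi | exists i (c : sub_lmod (dual_part i)), (\val c).1 = chi].

Fact dual_incl_subproof i (c : sub_lmod (dual_part i)) :
  (\val c).1 \in smem_pred dual_sum.
Proof. by apply/asboolP/sub_span; exists i, c. Qed.

Definition dual_incl_fun i (c : sub_lmod (dual_part i)) : sub_lmod dual_sum :=
  exist (fun chi => chi \in smem_pred dual_sum) _ (dual_incl_subproof c).

Fact dual_incl_linear i : linear (@dual_incl_fun i).
Proof. by move=> r c d; apply: val_inj. Qed.
HB.instance Definition _ i := GRing.isLinear.Build R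
  (sub_lmod (dual_part i)) (sub_lmod dual_sum) _ (@dual_incl_fun i)
  (@dual_incl_linear i).

Definition dual_incl i : {linear sub_lmod (dual_part i) -> sub_lmod dual_sum} :=
  @dual_incl_fun i.

Definition dual_proj_fun i j (c : sub_lmod (dual_part i)) : sub_lmod (D i j) :=
  (\val c).2 j.

Fact dual_proj_linear i j : linear (@dual_proj_fun i j).
Proof. by []. Qed.
HB.instance Definition _ i j := GRing.isLinear.Build R
  (sub_lmod (dual_part i)) (sub_lmod (D i j)) _ (@dual_proj_fun i j)
  (@dual_proj_linear i j).

Definition dual_proj i j : {linear sub_lmod (dual_part i) -> sub_lmod (D i j)} :=
  @dual_proj_fun i j.
End DualPart.

Fact full_submod0 (M : lmodType R) : [set: M] 0. Proof. by []. Qed.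
Fact full_submodP (M : lmodType R) (r : R) (x y : M) :
  [set: M] x -> [set: M] y -> [set: M] (r *: x + y).
Proof. by []. Qed.
Definition full_submod (M : lmodType R) : submodule M :=
  Submodule (@full_submod0 M) (@full_submodP M).

Fixpoint dual_sub (n : nat) : forall M : lmodType R, nfil n M -> submodule (homQZ M) :=
  match n with
  | 0 => fun M _ => full_submod (homQZ M)
  | m.+1 => fun M (F : filtration (nfil m) M) =>
      dual_sum (fun i j => dual_sub (quo_str F i j))
  end.

Definition dual_mod (n : nat) (M : lmodType R) (s : nfil n M) : lmodType R :=
  sub_lmod (dual_sub s).

Definition dual_ev (n : nat) (M : lmodType R) (s : nfil n M)
  (alpha : dual_mod s) (a : M) : QZ := \val (\val alpha) a.

(* [hat F i / hat F j = hat (F j / F i)], for the opposite order on indices. *)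
Fixpoint dual (n : nat) : forall (M : lmodType R) (s : nfil n M), nfil n (dual_mod s) :=
  match n with
  | 0 => fun _ _ => tt
  | m.+1 => fun M (F : filtration (nfil m) M) =>
      let D i j := dual_sub (quo_str F i j) in
      @Filtration (nfil m) (sub_lmod (dual_sum D)) _ (idx F)^d
        (fun i => sub_lmod (dual_part D i)) (@dual_incl _ _ F D)
        (fun j i => dual_mod (quo_str F i j)) (fun j i => @dual_proj _ _ F D i j)
        (fun j i => dual (quo_str F i j))
  end.

End Modules.

Arguments incl {R T M} F i : rename.
Arguments proj {R T M} F i j : rename.
Arguments quo_str {R T M} F i j : rename.

(* Elements of the limits are given by representing families: an element of
   [colim_i X_i] by a pair [existT _ i x], an element of [lim_j X_j] by a
   family.  [cvalid] says that such a family does represent an element of the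
   limit (all indices are in range and the family is compatible with the
   transition maps), and [cpull phi f f'] that [f'] represents [phi^* f]; two
   families represent the same element when they are related by
   [cpull idfun]. *)
Record contravariant (R : comPzRingType) (n : nat) := Contravariant {
  cspace : forall M : lmodType R, nfil n M -> Type;
  cvalid : forall (M : lmodType R) (s : nfil n M), cspace s -> Prop;
  cpull : forall (M N : lmodType R) (s : nfil n M) (t : nfil n N),
    (M -> N) -> cspace t -> cspace s -> Prop }.

(* The same for covariant functors; [vpush phi g g'] says that [g'] represents
   [phi_* g]. *)
Record covariant (R : comPzRingType) (n : nat) := Covariant {
  vspace : forall M : lmodType R, nfil n M -> Type;
  vvalid : forall (M : lmodType R) (s : nfil n M), vspace s -> Prop;
  vpush : forall (M N : lmodType R) (s : nfil n M) (t : nfil n N),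
    (M -> N) -> vspace s -> vspace t -> Prop }.

Section ContravariantLimits.
Variables (R : comPzRingType) (n : nat) (X : contravariant R n).

(* For [y] over [F j / F i] and [x] over [G l / G k], the pullbacks of [y]
   along [F j / F i0 -> F j / F i] and of [x] along the map
   [F j / F i0 -> G l / G k] induced by [phi] agree. *)
Definition pull_at (M N : lmodType R)
    (F : filtration (nfil n) M) (G : filtration (nfil n) N) (phi : M -> N)
    (i0 i j : idx F) (k l : idx G)
    (x : cspace X (quo_str G k l)) (y : cspace X (quo_str F i j)) : Prop :=
  exists (pi : {linear quo i0 j -> quo i j}) (psi : {linear quo i0 j -> quo k l})
         (z : cspace X (quo_str F i0 j)),
    [/\ induced idfun pi, induced phi psi, cvalid z, cpull pi y z & cpull psi x z].

(* lim_j colim_i X (F j / F i) *)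
Section LimColim.
Definition lc_space (M : lmodType R) (F : filtration (nfil n) M) : Type :=
  forall j : idx F, {i : idx F & cspace X (quo_str F i j)}.

Definition lc_valid (M : lmodType R) (F : filtration (nfil n) M)
    (f : lc_space F) : Prop :=
  (forall j, (tag (f j) <= j)%O /\ cvalid (tagged (f j))) /\
  (forall j k : idx F, (j <= k)%O ->
     exists2 i0, (i0 <= tag (f j))%O &
       pull_at idfun i0 (tagged (f k)) (tagged (f j))).

Definition lc_pull (M N : lmodType R)
    (F : filtration (nfil n) M) (G : filtration (nfil n) N) (phi : M -> N)
    (f : lc_space G) (f' : lc_space F) : Prop :=
  forall j : idx F, exists (l : idx G) (i0 : idx F),
    (i0 <= tag (f' j))%O /\ pull_at phi i0 (tagged (f l)) (tagged (f' j)).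

Definition lim_colim : contravariant R n.+1 :=
  @Contravariant R n.+1 lc_space lc_valid lc_pull.
End LimColim.

(* colim_i lim_j X (F j / F i) *)
Section ColimLim.
Definition cl_space (M : lmodType R) (F : filtration (nfil n) M) : Type :=
  {i : idx F & forall j : idx F, cspace X (quo_str F i j)}.

Definition cl_valid (M : lmodType R) (F : filtration (nfil n) M)
    (f : cl_space F) : Prop :=
  (forall j, (tag f <= j)%O -> cvalid (tagged f j)) /\
  (forall j k : idx F, (tag f <= j)%O -> (j <= k)%O ->
     exists2 alpha : {linear quo (tag f) j -> quo (tag f) k},
       induced idfun alpha & cpull alpha (tagged f k) (tagged f j)).

Definition cl_pull (M N : lmodType R)
    (F : filtration (nfil n) M) (G : filtration (nfil n) N) (phi : M -> N)
    (f : cl_space G) (f' : cl_space F) : Prop :=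
  exists2 i0 : idx F, (i0 <= tag f')%O &
    forall j : idx F, (tag f' <= j)%O ->
      exists2 l : idx G, (tag f <= l)%O &
        pull_at phi i0 (tagged f l) (tagged f' j).

Definition colim_lim : contravariant R n.+1 :=
  @Contravariant R n.+1 cl_space cl_valid cl_pull.
End ColimLim.
End ContravariantLimits.

Section CovariantLimits.
Variables (R : comPzRingType) (n : nat) (X : covariant R n).

(* For [x] over [F j / F i] and [y] over [G l / G k], the pushforwards of [y]
   along [G l / G k -> G l0 / G k] and of [x] along the map
   [F j / F i -> G l0 / G k] induced by [phi] agree. *)
Definition push_at (M N : lmodType R)
    (F : filtration (nfil n) M) (G : filtration (nfil n) N) (phi : M -> N)
    (i j : idx F) (k l l0 : idx G)
    (x : vspace X (quo_str F i j)) (y : vspace X (quo_str G k l)) : Prop :=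
  exists (alpha : {linear quo k l -> quo k l0}) (psi : {linear quo i j -> quo k l0})
         (z : vspace X (quo_str G k l0)),
    [/\ induced idfun alpha, induced phi psi, vvalid z, vpush alpha y z &
        vpush psi x z].

(* colim_j lim_i X (F j / F i) *)
Section ColimLim.
Definition vcl_space (M : lmodType R) (F : filtration (nfil n) M) : Type :=
  {j : idx F & forall i : idx F, vspace X (quo_str F i j)}.

Definition vcl_valid (M : lmodType R) (F : filtration (nfil n) M)
    (g : vcl_space F) : Prop :=
  (forall i, (i <= tag g)%O -> vvalid (tagged g i)) /\
  (forall h i : idx F, (h <= i)%O -> (i <= tag g)%O ->
     exists2 pi : {linear quo h (tag g) -> quo i (tag g)},
       induced idfun pi & vpush pi (tagged g h) (tagged g i)).

Definition vcl_push (M N : lmodType R)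
    (F : filtration (nfil n) M) (G : filtration (nfil n) N) (phi : M -> N)
    (g : vcl_space F) (g' : vcl_space G) : Prop :=
  exists2 l0 : idx G, (tag g' <= l0)%O &
    forall k : idx G, (k <= tag g')%O ->
      exists2 i : idx F, (i <= tag g)%O &
        push_at phi l0 (tagged g i) (tagged g' k).

Definition vcolim_lim : covariant R n.+1 :=
  @Covariant R n.+1 vcl_space vcl_valid vcl_push.
End ColimLim.

(* lim_i colim_j X (F j / F i) *)
Section LimColim.
Definition vlc_space (M : lmodType R) (F : filtration (nfil n) M) : Type :=
  forall i : idx F, {j : idx F & vspace X (quo_str F i j)}.

Definition vlc_valid (M : lmodType R) (F : filtration (nfil n) M)
    (g : vlc_space F) : Prop :=
  (forall i, (i <= tag (g i))%O /\ vvalid (tagged (g i))) /\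
  (forall h i : idx F, (h <= i)%O ->
     exists2 l0, (tag (g i) <= l0)%O &
       push_at idfun l0 (tagged (g h)) (tagged (g i))).

Definition vlc_push (M N : lmodType R)
    (F : filtration (nfil n) M) (G : filtration (nfil n) N) (phi : M -> N)
    (g : vlc_space F) (g' : vlc_space G) : Prop :=
  forall k : idx G, exists (i : idx F) (l0 : idx G),
    (tag (g' k) <= l0)%O /\ push_at phi l0 (tagged (g i)) (tagged (g' k)).

Definition vlim_colim : covariant R n.+1 :=
  @Covariant R n.+1 vlc_space vlc_valid vlc_push.
End LimColim.
End CovariantLimits.

Section Spaces.
Variables (K : realType) (R : comPzRingType).

Definition fun_pull : contravariant R 0 :=
  @Contravariant R 0 (fun M _ => M -> K[i]) (fun _ _ _ => True)
    (fun M N _ _ phi f f' => f' = f \o phi).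

Definition fun_push : covariant R 0 :=
  @Covariant R 0 (fun M _ => M -> K[i]) (fun _ _ _ => True)
    (fun M N _ _ phi g g' =>
       g' = fun x => \sum_(y \in [set y | phi y = x]) g y).

(* The letter [t] stands for the tilde. *)
Fixpoint E (n : nat) : contravariant R n :=
  if n is m.+1 then lim_colim (E m) else fun_pull.
Fixpoint Et (n : nat) : contravariant R n :=
  if n is m.+1 then colim_lim (Et m) else fun_pull.
Fixpoint E' (n : nat) : covariant R n :=
  if n is m.+1 then vcolim_lim (E' m) else fun_push.
Fixpoint Et' (n : nat) : covariant R n :=
  if n is m.+1 then vlim_colim (Et' m) else fun_push.

Definition pairing0 (M : lmodType R) (f g : M -> K[i]) : K[i] :=
  \sum_(a \in [set: M]) f a * g a.

Fixpoint pairing (n : nat) : forall (M : lmodType R) (s : nfil n M),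
    cspace (E n) s -> vspace (E' n) s -> K[i] :=
  match n with
  | 0 => fun M _ f g => pairing0 f g
  | m.+1 => fun M F f g =>
      pairing (tagged (f (tag g))) (tagged g (tag (f (tag g))))
  end.

Fixpoint tpairing (n : nat) : forall (M : lmodType R) (s : nfil n M),
    cspace (Et n) s -> vspace (Et' n) s -> K[i] :=
  match n with
  | 0 => fun M _ f g => pairing0 f g
  | m.+1 => fun M F f g =>
      tpairing (tagged f (tag (g (tag f)))) (tagged (g (tag f)))
  end.

(* Well defined: [repr q] is determined by [q] up to an integer. *)
Definition expQZ (q : QZ) : K[i] :=
  let x : K := 2 * pi * ratr (repr q) in (cos x +i* sin x)%C.

Definition fourier0 (M : lmodType R) (s : nfil 0 M) (f : M -> K[i]) :
    dual_mod s -> K[i] :=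
  fun alpha => (#|` fset_set [set: M]|%:R)^-1 *
    \sum_(a \in [set: M]) f a * expQZ (- dual_ev alpha a).

Definition fourier0' (M : lmodType R) (s : nfil 0 M) (f : M -> K[i]) :
    dual_mod s -> K[i] :=
  fun alpha => \sum_(a \in [set: M]) f a * expQZ (dual_ev alpha a).

(* For [n > 0] the transforms act componentwise: the component over
   [F j / F i] is sent to the component over [hat F i / hat F j], the indices
   of [hat F] being those of [F] with the opposite order. *)
Fixpoint fourier (n : nat) : forall (M : lmodType R) (s : nfil n M),
    cspace (E n) s -> vspace (Et' n) (dual s) :=
  match n with
  | 0 => fun M s f => fourier0 (s := s) f
  | m.+1 => fun M F f =>
      fun j => existT _ (tag (f j)) (fourier (tagged (f j)))
  end.

Fixpoint fourier' (n : nat) : forall (M : lmodType R) (s : nfil n M),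
    vspace (E' n) s -> cspace (Et n) (dual s) :=
  match n with
  | 0 => fun M s f => fourier0' (s := s) f
  | m.+1 => fun M F g =>
      existT _ (tag g) (fun i => fourier' (tagged g i))
  end.

Fixpoint tfourier (n : nat) : forall (M : lmodType R) (s : nfil n M),
    cspace (Et n) s -> vspace (E' n) (dual s) :=
  match n with
  | 0 => fun M s f => fourier0 (s := s) f
  | m.+1 => fun M F f =>
      existT _ (tag f) (fun j => tfourier (tagged f j))
  end.

Fixpoint tfourier' (n : nat) : forall (M : lmodType R) (s : nfil n M),
    vspace (Et' n) s -> cspace (E n) (dual s) :=
  match n with
  | 0 => fun M s f => fourier0' (s := s) f
  | m.+1 => fun M F g =>
      fun i => existT _ (tag (g i)) (tfourier' (tagged (g i)))
  end.

End Spaces.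

(* Main.v *)
Require Import Defs.
From mathcomp Require Import all_boot all_order all_algebra.
From mathcomp Require Import finmap generic_quotient ring_quotient complex.
From mathcomp Require Import all_classical all_reals all_analysis.
From mathcomp Require Import lra.

Set Implicit Arguments.
Unset Strict Implicit.
Unset Printing Implicit Defensive.

Import Order.TTheory GRing.Theory Num.Theory.

Local Open Scope classical_set_scope.
Local Open Scope quotient_scope.
Local Open Scope ring_scope.

(** Both pairings are evaluated on a single component: the one over
    [F j / F i], where [j] is the index attached to the inductive limit in one
    argument and [i] the index which the other argument attaches to [j], or
    vice versa.  The Fourier transforms act componentwise and keep these
    indices, only reading them in the opposite order, so that the components
    of the transforms which get paired are the transforms of the components
    that were paired before.  Hence the formula descends from [A] to
    [F j / F i], and by induction on [n] to the case of a finite module; this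
    is [plancherel_E] and, over the dual, [plancherel_Et_dual].

    For a finite module [M], expanding both transforms leaves
    [1/|M|] times the sum of [f a * g b * e(alpha(b - a))] over [a], [b] and
    [alpha], and the formula amounts to the orthogonality relation
    [sum_dual]: the sum of [e(alpha(c))] over all characters [alpha] is [|M|]
    for [c = 0] and vanishes otherwise.  A sum of values of a multiplicative
    character of a finite group vanishes unless the character is trivial
    ([sum_char_eq0]); so one needs that every [c != 0] is detected by some
    character ([separating_char]), and that [M] has [|M|] characters.  The
    latter follows by summing [e(alpha(a))] over all [alpha] and [a] in both
    orders.  Separation rests on the divisibility of [Q/Z], which permits to
    extend characters from subgroups ([pchar_extend]).  Over the dual, the
    same relation is used for the finite module [dual_mod s]
    ([finite_dual_mod]). *)

(** * The exponential on Q/Z *)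

Lemma QZ_pi_eq0 (r : rat) : (\pi_QZ r == 0 :> QZ) = (r \is a Num.int).
Proof.
by rewrite -[LHS](congr1 (eq_op _) (raddf0 \pi_QZ)) -Quotient.idealrBE subr0.
Qed.

Section Turn.
Variable K : realType.
Implicit Types (x y : K) (p q : QZ).

(** The complex exponential of [2 pi i x]. *)
Definition turn x : K[i] := (cos (2 * pi * x) +i* sin (2 * pi * x))%C.

Lemma turnD x y : turn (x + y) = turn x * turn y.
Proof.
by rewrite /turn mulrDr cosD sinD; apply/eqP; rewrite eq_complex /= eqxx addrC eqxx.
Qed.

Lemma turn0 : turn 0 = 1.
Proof. by rewrite /turn mulr0 cos0 sin0. Qed.

Lemma turn_nat n : turn n%:R = 1.
Proof.
elim: n => [|n IHn]; first exact: turn0.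
by rewrite -addn1 natrD turnD IHn mul1r /turn mulr1 mulr_natl cos2pi sin2pi.
Qed.

Lemma turn_int x : x \is a Num.int -> turn x = 1.
Proof.
move=> /intrP[[n|n] ->]; first exact: turn_nat.
have : turn (- n.+1%:R) * turn n.+1%:R = 1 by rewrite -turnD addNr turn0.
by rewrite turn_nat mulr1 NegzE mulrNz.
Qed.

(** Up to an integer [0 <= x < 1], and [cos (2 pi x) = 1 - 2 sin^2 (pi x)],
    where the sine has no zero strictly between [0] and [pi]. *)
Lemma turn_eq1 x : turn x = 1 -> x \is a Num.int.
Proof.
move=> x1; pose y := x - (Num.floor x)%:~R.
have y1 : turn y = 1.
  by rewrite turnD x1 mul1r turn_int// rpredN intr_int.
have /andP[y_ge0 y_lt1] : 0 <= y < 1.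
  by rewrite subr_ge0 Num.Theory.floor_le ltrBlDl -intrD1 Num.Theory.floorD1_gt.
have [y0|y_neq0] := eqVneq y 0.
  by rewrite (_ : x = (Num.floor x)%:~R) ?intr_int//; apply/subr0_eq.
have : cos (pi * y *+ 2) = 1.
  have : complex.Re (turn y) = 1 by rewrite y1.
  by rewrite /= -mulrA mulr_natl.
have : 0 < sin (pi * y).
  have := pi_gt0 K => pi_gt0.
  apply: sin_gt0_pi; rewrite mulr_gt0//=; last by rewrite lt_def y_neq0.
  by rewrite -[ltRHS]mulr1 ltr_pM2l.
rewrite cos_mulr2n cos2sin2 mulr2n => s_gt0 s_eq0.
have : sin (pi * y) ^+ 2 > 0 by rewrite exprn_gt0.
by move: s_eq0; lra.
Qed.

Lemma expQZ_pi (r : rat) : expQZ K (\pi_QZ r) = turn (ratr r).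
Proof.
have rep_int : repr (\pi_QZ r) - r \in int_pred.
  by rewrite Quotient.idealrBE; apply/eqP; exact: reprK.
have -> : expQZ K (\pi_QZ r) = turn (ratr (repr (\pi_QZ r))) by [].
rewrite -[X in turn (ratr X)](subrK r) rmorphD turnD turn_int ?mul1r//.
by have /intrP[m ->] := rep_int; rewrite rmorph_int intr_int.
Qed.

Lemma expQZD p q : expQZ K (p + q) = expQZ K p * expQZ K q.
Proof.
by rewrite -[p]reprK -[q]reprK -raddfD !expQZ_pi rmorphD turnD.
Qed.

Lemma expQZ0 : expQZ K 0 = 1.
Proof. by rewrite -[0](raddf0 \pi_QZ) expQZ_pi rmorph0 turn0. Qed.

Lemma expQZ_eq1 q : expQZ K q = 1 -> q = 0.
Proof.
rewrite -[q]reprK expQZ_pi => /turn_eq1 /intrP[m].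
by rewrite -(ratr_int K) => /fmorph_inj ->; apply/eqP; rewrite QZ_pi_eq0 intr_int.
Qed.
End Turn.

(** * Extension of characters with values in Q/Z *)

Lemma QZ_divisible (p : QZ) k : exists q : QZ, q *+ k.+1 = p.
Proof.
exists (\pi_QZ (repr p / k.+1%:R)).
by rewrite -raddfMn -[_ / _ *+ _]mulr_natr divfK ?pnatr_eq0//; exact: reprK.
Qed.

Lemma QZ_torsion_neq0 k : exists2 q : QZ, q != 0 & q *+ k.+2 = 0.
Proof.
exists (\pi_QZ k.+2%:R^-1); last first.
  rewrite -raddfMn -[_^-1 *+ _]mulr_natr mulVf ?pnatr_eq0//.
  by apply/eqP; rewrite QZ_pi_eq0.
rewrite QZ_pi_eq0; apply/negP => /intrP[m e].
have : (m * k.+2)%:~R = 1 :> rat by rewrite intrM -e mulVf ?pnatr_eq0.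
move/eqP; rewrite -[1]/(1%:~R) eqr_int => /eqP/(congr1 absz).
by rewrite abszM /= => /eqP; rewrite muln_eq1 andbF.
Qed.

Section Extension.
Variable G : zmodType.
Hypothesis torsion : forall x : G, exists k, x *+ k.+1 = 0.

(** A character of a subgroup of [G] is encoded by its graph.  In this form an
    extension is a larger subgroup of [G * Q/Z], and only its functionality
    has to be checked. *)
Record partial_char (H : set (G * QZ)) : Prop := PartialChar {
  pchar0 : H 0;
  pcharB : forall u v, H u -> H v -> H (u - v);
  pchar_fun : forall q, H (0, q) -> q = 0 }.

Section Step.
Variable H : set (G * QZ).
Hypothesis HP : partial_char H.

Lemma pcharN u : H u -> H (- u).
Proof. by move=> Hu; rewrite -[- u]add0r; apply: (pcharB HP) => //; apply: pchar0. Qed.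

Lemma pcharD u v : H u -> H v -> H (u + v).
Proof. by move=> Hu Hv; rewrite -[v]opprK; apply: (pcharB HP) => //; apply: pcharN. Qed.

Lemma pcharMn u n : H u -> H (u *+ n).
Proof.
move=> Hu; elim: n => [|n IHn]; first by rewrite mulr0n; apply: pchar0.
by rewrite mulrS; apply: pcharD.
Qed.

Lemma pcharMz u m : H u -> H (u *~ m).
Proof.
by move=> Hu; case: m => n; rewrite ?NegzE ?mulrNz; [|apply: pcharN]; exact: pcharMn.
Qed.

(** Let [k + 1] be the order of [x] modulo the domain of [H], so that [H] has a
    value [qk] at [(k + 1) x].  As [Q/Z] is divisible, some [q] satisfies
    [(k + 1) q = qk], and [x |-> q] extends [H].  If [q = 0] and [x] is outside
    the domain, then [k > 0], and a nonzero [(k + 1)]-torsion element does as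
    well; that [q] can be chosen nonzero is what makes characters separate
    points. *)
Lemma pchar_extend x : exists H' q,
  [/\ partial_char H', H `<=` H', H' (x, q) & (forall p, ~ H (x, p)) -> q != 0].
Proof.
pose D k := `[< exists q, H (x *+ k.+1, q) >].
have exD : exists k, D k.
  have [k xk] := torsion x; exists k; apply/asboolP; exists 0.
  by rewrite xk; exact: (pchar0 HP).
case: (ex_minnP exD) => k /asboolP[qk Hk] kmin.
have [q qE qN0] : exists2 q, q *+ k.+1 = qk & (forall p, ~ H (x, p)) -> q != 0.
  have [q qE] := QZ_divisible qk k; have [q0|] := eqVneq q 0; last by exists q.
  case: k => [|k] in kmin Hk qE *.
    by exists q => // /(_ qk).
  by have [r r0 rk] := QZ_torsion_neq0 k; exists r => //; rewrite rk -qE q0 mul0rn.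
exists [set u | exists m : int, H (u - (x, q) *~ m)], q; split => //; first split.
- by exists 0; rewrite mulr0z subr0; exact: (pchar0 HP).
- move=> u v [m Hm] [l Hl]; exists (m - l).
  rewrite (_ : _ - _ = (u - (x, q) *~ m) - (v - (x, q) *~ l)); first exact: (pcharB HP).
  by rewrite mulrzBr !opprD addrACA.
- move=> p [m Hm].
  (* [m x] lies in the domain of [H]; division by [k + 1] leaves a remainder
     which does too, hence is zero by minimality of [k]. *)
  have {}Hm : H ((x, q) *~ m - (0, p)) by rewrite -opprB; apply: pcharN.
  have Hxk : H ((x, q) *~ k.+1) by rewrite -pmulrn pairMnE /= qE.
  have [r rk mE] : exists2 r : nat, (r < k.+1)%N & m = (m %/ k.+1)%Z * k.+1 + r.
    exists `|(m %% k.+1)%Z|%N; last by rewrite gez0_abs ?modz_ge0// -divz_eq.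
    by rewrite -ltz_nat gez0_abs ?modz_ge0// ltz_pmod.
  have {}Hm : H ((x, q) *+ r - (0, p)).
    rewrite (_ : _ - _ = (x, q) *~ m - (0, p) - (x, q) *~ k.+1 *~ (m %/ k.+1)%Z).
      by apply: (pcharB HP) => //; exact: pcharMz.
    rewrite -mulrzA [_ * (_ %/ _)%Z]mulrC addrAC; congr (_ - _).
    by rewrite -mulrzBr [X in X - _]mE addrAC subrr add0r pmulrn.
  case: r => [|r] in rk Hm mE *.
    by move: Hm; rewrite mulr0n add0r => /pcharN; rewrite opprK; exact: (pchar_fun HP).
  have : D r.
    apply/asboolP; exists (q *+ r.+1 - p).
    rewrite (_ : (_, _) = (x, q) *+ r.+1 - (0, p))//.
    by rewrite pairMnE; congr pair; rewrite /= subr0.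
  by move=> /kmin; rewrite leqNgt -ltnS rk.
- by move=> u Hu; exists 0; rewrite mulr0z subr0.
- by exists 1; rewrite mulr1z subrr; exact: (pchar0 HP).
Qed.
End Step.
End Extension.

(** * Characters of finite abelian groups *)

Lemma finite_torsion (G : zmodType) : finite_set [set: G] ->
  forall x : G, exists k, x *+ k.+1 = 0.
Proof.
move=> finG x; apply: contrapT => xP; apply: infinite_nat.
rewrite -(preimage_setT (fun n => x *+ n)); apply: finite_preimage => //.
have key m n : (m < n)%N -> x *+ m <> x *+ n.
  move=> mn e; apply: xP; exists (n - m).-1.
  by rewrite prednK ?subn_gt0// mulrnBr ?e ?subrr// ltnW.
by move=> m n _ _ e; case: (ltngtP m n) => // /key; rewrite e.
Qed.

Lemma finite_exponent (G : zmodType) : finite_set [set: G] ->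
  exists N, forall x : G, x *+ N.+1 = 0.
Proof.
move=> finG; have /finite_seqP[l lE] := finG.
have [N NP] : exists N, forall x, x \in l -> x *+ N.+1 = 0.
  elim: {lE} l => [|x l [N NP]]; first by exists 0%N.
  have [k xk] := finite_torsion finG x; exists (k.+1 * N.+1).-1 => y.
  rewrite prednK ?muln_gt0// inE => /predU1P[->|yl]; first by rewrite mulrnA xk mul0rn.
  by rewrite mulnC mulrnA NP ?mul0rn.
by exists N => x; apply: NP; have : [set: G] x by []; rewrite lE.
Qed.

Lemma QZ_torsionE N (q : QZ) : q *+ N.+1 = 0 ->
  exists k : 'I_N.+1, q = \pi_QZ (k%:R / N.+1%:R).
Proof.
rewrite -[q]reprK -raddfMn => /eqP; rewrite QZ_pi_eq0 => /intrP[m mE].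
have rE : repr q = m%:~R / N.+1%:R.
  by rewrite -mE -[_ *+ _ in RHS]mulr_natr mulfK ?pnatr_eq0.
have kN : (`|(m %% N.+1)%Z| < N.+1)%N.
  by rewrite -ltz_nat gez0_abs ?modz_ge0// ltz_pmod.
exists (Ordinal kN) => /=; apply/eqP; rewrite -Quotient.idealrBE rE.
rewrite (_ : `|(m %% N.+1)%Z|%N%:R = (m %% N.+1)%Z%:~R); last first.
  by rewrite pmulrn gez0_abs ?modz_ge0.
rewrite -mulrBl -intrB.
rewrite {1}(divz_eq m N.+1) addrK intrM mulfK ?pnatr_eq0//; exact: intr_int.
Qed.

(** If [N + 1] kills [G], characters take values in the finite
    [(N + 1)]-torsion of [Q/Z]; [c] labels these values by ordinals. *)
Lemma finite_dual (G : zmodType) : finite_set [set: G] ->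
  finite_set [set h : G -> QZ | {morph h : x y / x + y}].
Proof.
move=> finG; have [N NP] := finite_exponent finG.
have /choice[c cP] (q : QZ) : exists k : 'I_N.+1,
    q *+ N.+1 = 0 -> q = \pi_QZ (k%:R / N.+1%:R).
  have [/QZ_torsionE[k ->]|qN] := pselect (q *+ N.+1 = 0); first by exists k.
  by exists ord0.
pose T := fset_set [set: G].
pose code (h : G -> QZ) := [ffun x : T => c (h (val x))].
rewrite -(eq_finite_set (inj_card_eq (f := code) _)); first exact: finite_finset.
move=> h h' /set_mem hD /set_mem h'D e; apply/funext => x.
have xT : x \in T by rewrite in_fset_set// inE.
have /ffunP/(_ [` xT]%fset) := e; rewrite !ffunE /= => ce.
have tor (u : G -> QZ) : {morph u : x y / x + y} -> u x *+ N.+1 = 0.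
  move=> uD; have u0 : u 0 = 0 by apply: (addrI (u 0)); rewrite -uD !addr0.
  rewrite -[RHS]u0 -(NP x); elim: N.+1 => [|n IHn]; first by rewrite !mulr0n u0.
  by rewrite !mulrS uD IHn.
by rewrite (cP _ (tor _ hD)) (cP _ (tor _ h'D)) ce.
Qed.

(** The zero character of the trivial subgroup extends to [c] with a nonzero
    value there, then to the elements of [G] one after the other. *)
Lemma separating_char (G : zmodType) (c : G) : finite_set [set: G] -> c != 0 ->
  exists2 h : G -> QZ, {morph h : x y / x + y} & h c != 0.
Proof.
move=> finG c0; have torG := finite_torsion finG.
have H0P : partial_char [set 0 : G * QZ].
  split=> [|u v -> ->|q e]; [by []|exact: subr0|exact: (congr1 snd e)].
have [H1 [q [H1P _ H1c q0]]] := pchar_extend torG H0P c.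
have {}q0 : q != 0 by apply: q0 => p /(congr1 fst) /= c_eq0; rewrite c_eq0 eqxx in c0.
have /finite_seqP[l lE] := finG.
have [H [HP H1H Hl]] : exists H, [/\ partial_char H, H1 `<=` H &
    forall x, x \in l -> exists p, H (x, p)].
  elim: {lE} l => [|x l [H [HP H1H Hl]]]; first by exists H1; split.
  have [H' [p [H'P HH' H'x _]]] := pchar_extend torG HP x.
  exists H'; split => // [u /H1H/HH'//|y]; rewrite inE => /predU1P[->|/Hl[r /HH']].
    by exists p.
  by exists r.
have /choice[h hP] (x : G) : exists p, H (x, p).
  by apply: Hl; have : [set: G] x by []; rewrite lE.
have Huniq x p : H (x, p) -> h x = p.
  move=> Hxp; apply/subr0_eq/(pchar_fun HP); rewrite -(subrr x).
  exact: (pcharB HP (hP x) Hxp).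
exists h; last by rewrite (Huniq _ _ (H1H _ H1c)).
by move=> x y; apply: Huniq; exact: (pcharD HP (hP x) (hP y)).
Qed.

(** * Orthogonality relations *)

Section Orthogonality.
Variables (K : realType) (G : zmodType).

(** Translation by [x0] permutes the summands and multiplies the sum by
    [X x0]. *)
Lemma sum_char_eq0 (X : G -> K[i]) (x0 : G) :
  {morph X : x y / x + y >-> x * y} -> X x0 != 1 -> \sum_(x \in [set: G]) X x = 0.
Proof.
move=> XD X1; set S := \sum_(x \in _) _.
have SE : S = X x0 * S.
  rewrite mulr_fsumr /S (reindex_fsbigT (+%R x0)); last first.
    by exists (fun x => - x0 + x) => x; [exact: addKr|exact: addNKr].
  by apply: eq_fsbigr => x _; rewrite XD.
have : (X x0 - 1) * S = 0 by rewrite mulrBl mul1r -SE subrr.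
by move/eqP; rewrite mulf_eq0 subr_eq0 (negbTE X1) => /eqP.
Qed.

Lemma sum_expQZ (h : G -> QZ) : {morph h : x y / x + y} ->
  \sum_(x \in [set: G]) expQZ K (h x) =
  if `[< forall x, h x = 0 >] then \sum_(x \in [set: G]) (1 : K[i]) else 0.
Proof.
move=> hD; case: ifPn => [/asboolP h0|/asboolP/existsNP[x /eqP hx]].
  by apply: eq_fsbigr => x _; rewrite h0 expQZ0.
apply: (sum_char_eq0 (x0 := x)) => [y z|]; first by rewrite hD expQZD.
by apply: contra hx => /eqP/expQZ_eq1 ->.
Qed.

End Orthogonality.

(** * The Plancherel formula for finite modules *)

Section Plancherel0.
Variables (K : realType) (R : comPzRingType) (M : lmodType R) (s : nfil 0 M).
Hypothesis finM : finite_set [set: M].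
Implicit Types (a b : M) (al be : dual_mod s).

Lemma dual_evDr al : {morph dual_ev al : a b / a + b}.
Proof. by have /asboolP := valP (val al). Qed.

Lemma dual_evDl a : {morph (@dual_ev _ _ _ s)^~ a : al be / al + be}.
Proof. by []. Qed.

Lemma dual_ev_inj al : (forall a, dual_ev al a = 0) -> al = 0.
Proof. by move=> al0; apply: val_inj; apply: val_inj; apply/funext. Qed.

Lemma dual_ev_sep a : a != 0 -> exists al, dual_ev al a != 0.
Proof.
move=> /(separating_char finM)[h /asboolP hP ha].
pose h' : homQZ M := exist _ h hP.
have h'P : h' \in smem_pred (full_submod (homQZ M)) by apply/asboolP.
by exists (exist (fun x => x \in smem_pred (full_submod (homQZ M))) h' h'P).
Qed.

Lemma finite_dual_mod : finite_set [set: dual_mod s].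
Proof.
pose emb (al : dual_mod s) : M -> QZ := dual_ev al.
have -> : [set: dual_mod s] = emb @^-1` [set h : M -> QZ | {morph h : x y / x + y}].
  by apply/esym/seteqP; split => // al _; exact: dual_evDr.
apply: finite_preimage; last exact: finite_dual.
by move=> al be _ _ e; apply: val_inj; apply: val_inj.
Qed.

Let N : K[i] := \sum_(a \in [set: M]) (1 : K[i]).

(** The same relation with the number of characters in place of [N] is the
    vanishing of character sums on the dual; that the two numbers agree is
    seen by evaluating the double sum over all characters and all elements in
    both orders, one of them using the vanishing of character sums on [M]. *)
Lemma sum_dual a : \sum_(al \in [set: dual_mod s]) expQZ K (dual_ev al a) =
  if a == 0 then N else 0.
Proof.
have orth b : \sum_(al \in [set: dual_mod s]) expQZ K (dual_ev al b) =
    if b == 0 then \sum_(al \in [set: dual_mod s]) (1 : K[i]) else 0.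
  rewrite (sum_expQZ K (dual_evDl b)); congr (if _ then _ else _).
  apply/asboolP/eqP => [b0|-> al].
    by apply: contrapT => /eqP/dual_ev_sep[al]; rewrite b0 eqxx.
  by apply: (addrI (dual_ev al 0)); rewrite -dual_evDr !addr0.
rewrite orth; case: eqP => // _.
transitivity (\sum_(al \in [set: dual_mod s]) \sum_(b \in [set: M])
    expQZ K (dual_ev al b)).
  rewrite exchange_fsbig //; last exact: finite_dual_mod.
  rewrite [RHS](fsbigD1 0)//= orth eqxx [X in _ + X]fsbig1 ?addr0// => b [_ /= /eqP b0].
  by rewrite orth (negbTE b0).
rewrite [LHS](fsbigD1 0)//=; last exact: finite_dual_mod.
rewrite (sum_expQZ K (dual_evDr 0)) asboolT// [X in _ + X]fsbig1 ?addr0//.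
move=> al [_ /= al0].
by rewrite (sum_expQZ K (dual_evDr al)) asboolF// => /dual_ev_inj.
Qed.

Lemma plancherel0 (f g : M -> K[i]) :
  pairing0 f g = pairing0 (fourier0' (s := s) g) (fourier0 (s := s) f).
Proof.
have NE : #|` fset_set [set: M]|%:R = N.
  by rewrite /N fsbig_finite// big_const_seq count_predT iter_addr addr0.
have N0 : N != 0.
  rewrite -NE pnatr_eq0 cardfs_eq0; apply/eqP => T0.
  have : 0 \in fset_set [set: M] by rewrite in_fset_set// inE.
  by rewrite T0 in_fset0.
rewrite /pairing0 /fourier0 /fourier0' NE.
transitivity (N^-1 * \sum_(a \in [set: M]) \sum_(b \in [set: M])
    \sum_(al \in [set: dual_mod s]) f a * g b * expQZ K (dual_ev al (b - a))).
  rewrite mulr_fsumr; apply: eq_fsbigr => a _.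
  rewrite (fsbigD1 a)//= -mulr_fsumr sum_dual subrr eqxx [X in _ + X]fsbig1.
    by rewrite addr0 mulrCA mulVf ?mulr1.
  by move=> b [_ /= /eqP ba]; rewrite -mulr_fsumr sum_dual subr_eq0 (negbTE ba) mulr0.
transitivity (N^-1 * \sum_(al \in [set: dual_mod s]) \sum_(a \in [set: M])
    \sum_(b \in [set: M]) f a * g b * expQZ K (dual_ev al (b - a))).
  congr (_ * _); rewrite [RHS]exchange_fsbig //; last exact: finite_dual_mod.
  by apply: eq_fsbigr => a _; rewrite exchange_fsbig //; exact: finite_dual_mod.
rewrite mulr_fsumr; apply: eq_fsbigr => al _.
rewrite mulrCA; congr (_ * _); rewrite mulr_fsumr; apply: eq_fsbigr => a _.
rewrite mulr_fsuml; apply: eq_fsbigr => b _.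
have -> : dual_ev al (b - a) = dual_ev al b - dual_ev al a.
  by apply: (addIr (dual_ev al a)); rewrite -dual_evDr !subrK.
by rewrite expQZD [f a * g b]mulrC mulrACA.
Qed.
End Plancherel0.

(** * Induction along the filtrations *)

(** The induction passes to the component over [F j / F i], [j = tag g] and
    [i = tag (f j)].  Validity of [f] gives [i <= j], which makes
    [F j / F i] an object of the lower category and the component of [g] over
    it valid. *)
Lemma plancherel_E (K : realType) (R : comPzRingType) n
    (A : lmodType R) (s : nfil n A)
    (f : cspace (E K R n) s) (g : vspace (E' K R n) s) :
  in_A s -> cvalid f -> vvalid g -> pairing f g = tpairing (fourier' g) (fourier f).
Proof.
elim: n A s f g => [|n IHn] A s f g /=; first by move=> finA _ _; exact: plancherel0.
move=> [_ sA _] [fP _] [gP _]; have [ij fij] := fP (tag g).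
by apply: IHn => //; [exact: sA|exact: gP].
Qed.

(** The quotients of the dual filtration are the duals of the [F j / F i], so
    that the induction runs over [s] rather than over [dual s]; the finite
    case is that of the module [dual_mod s]. *)
Lemma plancherel_Et_dual (K : realType) (R : comPzRingType) n
    (A : lmodType R) (s : nfil n A)
    (f : cspace (Et K R n) (dual s)) (g : vspace (Et' K R n) (dual s)) :
  in_A s -> cvalid f -> vvalid g ->
  tpairing f g = pairing (tfourier' g) (tfourier f).
Proof.
elim: n A s f g => [|n IHn] A s f g /=.
  by move=> finA _ _; apply: plancherel0; exact: finite_dual_mod.
move=> [_ sA _] [fP _] [gP _]; have [ij gij] := gP (tag f).
by apply: IHn => //; [exact: sA|exact: fP].
Qed.

Theorem theorem5p2 (K : realType) (R : comPzRingType) (n : nat)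
    (A : lmodType R) (s : nfil n A) (hA : in_S s) :
  (forall (f : cspace (E K R n) s) (g : vspace (E' K R n) s),
     cvalid f -> vvalid g ->
     pairing f g = tpairing (fourier' g) (fourier f)) /\
  (forall (f : cspace (Et K R n) (dual s)) (g : vspace (Et' K R n) (dual s)),
     cvalid f -> vvalid g ->
     tpairing f g = pairing (tfourier' g) (tfourier f)).
Proof.
by have [sA _] := hA; split=> f g fP gP; [exact: plancherel_E|exact: plancherel_Et_dual].
Qed.
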